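(* (Stokes' theorem for nonsmooth chains) Let $1\le n\le m$ be integers and let $\lambda$ be a real number with $n\le\lambda\le m$. If $A\in X_{n,\lambda}(\mathbb{R}^m)$ and $\omega$ is an $(n-1)$-form of class $C^{\lambda-n+1}$ defined on $\mathbb{R}^m$, then $$\int_A d\omega=\int_{\partial A}\omega .$$
   Context: Simplicial chains. An $n$-simplex $\sigma=p_0\cdots p_n$ is the convex hull of $n+1$ points; it is degenerate if the vectors $p_0-p_i$ ($1\le i\le n$) are linearly dependent. The order of the vertices orients a nondegenerate simplex, and $-\sigma$ is the same point set with the opposite orientation. A simplicial $n$-chain in an oriented affine $n$-plane $P$ is an equivalence class of finite formal sums $\sum a_i\sigma_i$, with $a_i\in\mathbb{R}$ and $\sigma_i$ oriented $n$-simplices in $P$. Such a sum defines the function $x\mapsto\sum\pm a_i$, the sum being over those $i$ with $x\in\operatorname{int}(\sigma_i)$ (interior in $P$), with sign $+$ if $\sigma_i$ is oriented as $P$ and $-$ otherwise, and value $0$ if $x$ lies in no such interior. Two formal sums are equivalent if their functions agree except on a set of $n$-dimensional Lebesgue measure zero; degenerate simplices represent the zero chain. The notion does not depend on the orientation chosen for $P$. Let $C_n(P)$ be the linear space of simplicial $n$-chains in $P$. A simplicial $n$-chain in $\mathbb{R}^m$ ($m\ge n$) is an element of the direct sum of the spaces $C_n(P)$ over all affine $n$-planes $P\subset\mathbb{R}^m$ (for $n=0$: finite real combinations of points). Write $\sum a_i\sigma_i\sim A$ if the formal sum of oriented $n$-simplices in $\mathbb{R}^m$ represents $A$. The boundary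 $\partial$ on simplicial chains is the usual simplicial boundary, and $\int_A\omega=\sum a_i\int_{\sigma_i}\omega$ if $\sum a_i\sigma_i\sim A$ (for $n=0$, $\int_{p}\omega=\omega(p)$). Projected masses. $M_n(\sigma)$ denotes the $n$-dimensional volume of an $n$-simplex $\sigma$. For a simplicial $n$-chain $A$ in $\mathbb{R}^m$, an orthogonal projection $\pi$ onto an affine subspace of $\mathbb{R}^m$, and $0\le\lambda\le n$, put $$M_{\lambda,\pi}(A)=\inf\Big\{\sum|a_i|\,\big(M_n(\pi\sigma_i)\big)^{\lambda/n}:\ \sum a_i\sigma_i\sim A\Big\}$$ (for $n=\lambda=0$ this is read as $\inf\sum|a_i|$). Natural norms. Let $A$ be a simplicial $n$-chain in $\mathbb{R}^m$, let $N=\binom{m}{n}$, and let $\pi_1,\dots,\pi_N$ be the orthogonal projections onto the $n$-dimensional coordinate planes of $\mathbb{R}^m$. If $0\le\lambda\le n$, set $$|A|^\natural_\lambda=\sum_{i=1}^N M_{\lambda,\pi_i}(A).$$ If $n<\lambda\le m$, define recursively $$|A|^\natural_\lambda=\sum_{i=1}^N\inf_C\big\{M_{n,\pi_i}(A-\partial C)+|C|^\natural_\lambda\big\},$$ each infimum being over all simplicial $(n+1)$-chains $C$ in $\mathbb{R}^m$, where $|C|^\natural_\lambda$ is the $\lambda$-natural norm of the $(n+1)$-chain $C$ (recursion on the integer part of $\lambda-n$). The space $X_{n,\lambda}=X_{n,\lambda}(\mathbb{R}^m)$ is the Banach space completion of the space of simplicial $n$-chains in $\mathbb{R}^m$ with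 respect to $|\cdot|^\natural_\lambda$. The boundary operator on simplicial chains extends to a continuous operator $\partial:X_{n,\lambda}\to X_{n-1,\lambda}$; this is the meaning of $\partial A$ for $A\in X_{n,\lambda}$. Forms and integrals. For $r=k+\alpha$ with $k\ge0$ an integer and $0\le\alpha<1$, a form is of class $C^r$ if its coefficients have continuous partial derivatives of all orders $\le k$, bounded on $\mathbb{R}^m$, and, if $\alpha>0$, the $k$-th order partial derivatives are $\alpha$-Hölder on $\mathbb{R}^m$. For an $n$-form $\eta$ of class $C^{\lambda-n}$ on $\mathbb{R}^m$, the linear map $A\mapsto\int_A\eta$ on simplicial $n$-chains is bounded with respect to $|\cdot|^\natural_\lambda$ and so extends uniquely to a bounded linear functional $L_\eta$ on $X_{n,\lambda}$; for $A\in X_{n,\lambda}$ one defines $\int_A\eta=L_\eta(A)$. The same definition, with $n-1$ in place of $n$, gives $\int_B\omega$ for $B\in X_{n-1,\lambda}$ and an $(n-1)$-form $\omega$ of class $C^{\lambda-n+1}$.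
   Formalization: The bounded extensions defining the integrals of dω over X_{n,λ} and of ω over X_{n-1,λ} are assumed to exist; for non-integer λ they can fail to exist (e.g. m=3, n=2, 2<λ<3), so equality is asserted whenever both integrals are defined. *)

(* Defs.v *)
From HB Require Import structures.
From mathcomp Require Import all_boot all_order all_algebra.
From mathcomp Require Import all_classical all_reals all_analysis.

Set Implicit Arguments.
Unset Strict Implicit.
Unset Printing Implicit Defensive.

Import Order.TTheory GRing.Theory Num.Theory.
Import numFieldNormedType.Exports.

Local Open Scope classical_set_scope.
Local Open Scope ring_scope.

(* World: MathComp-Analysis, over [R : realType].  Points of R^m are row vectors ['rV[R]_m]; the norm on ['rV[R]_m] is the sup norm. *)

Section Simplices.
Variables (R : realType) (m : nat).

(* The n-simplex p_0 ... p_n is the matrix whose i-th row is the vertex p_i. *)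
Definition simplex (n : nat) := 'M[R]_(n.+1, m).

Definition edges (n : nat) (s : simplex n) : 'M[R]_(n, m) :=
  \matrix_(i, j) (s (lift ord0 i) j - s ord0 j).

Definition hull (n : nat) (s : simplex n) : set 'rV[R]_m :=
  [set x | exists b : 'rV[R]_n.+1,
     [/\ forall i, 0 <= b 0 i, \sum_i b 0 i = 1 & x = b *m s]].

(* n-dimensional volume, by the Gram determinant of the edges. *)
Definition volume (n : nat) (s : simplex n) : R :=
  Num.sqrt (\det (edges s *m (edges s)^T)) / n`!%:R.

Definition simplex_map (f : 'rV[R]_m -> 'rV[R]_m) (n : nat) (s : simplex n) :
  simplex n := \matrix_i f (row i s).

(* Orthogonal projection onto the coordinate plane spanned by the axes of [I]. *)
Definition coord_proj (I : {set 'I_m}) (x : 'rV[R]_m) : 'rV[R]_m :=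
  \row_j (if j \in I then x 0 j else 0).

End Simplices.

(* A set is Lebesgue null in R^n when it has countable covers by closed boxes of
   arbitrarily small total volume.  The covers are indexed by subsets of [nat]
   so that for n = 0, where each box has volume 1, exactly the empty set is
   null. *)
Definition lebesgue_null (R : realType) (n : nat) (E : set 'rV[R]_n) : Prop :=
  forall e : R, 0 < e ->
  exists (J : set nat) (a b : nat -> 'rV[R]_n),
    [/\ forall k i, a k 0 i <= b k 0 i,
        E `<=` \bigcup_(k in J) [set t | forall i, a k 0 i <= t 0 i <= b k 0 i]
      & (\esum_(k in J) (\prod_(i < n) (b k 0 i - a k 0 i))%:E <= e%:E)%E].

Lemma lebesgue_null_sub (R : realType) n (E F : set 'rV[R]_n) :
  E `<=` F -> lebesgue_null F -> lebesgue_null E.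
Proof.
move=> EF F0 e /F0[J [a [b [ab Fab le]]]].
by exists J, a, b; split=> //; exact: subset_trans Fab.
Qed.

Lemma lebesgue_null0 (R : realType) n : lebesgue_null (set0 : set 'rV[R]_n).
Proof.
move=> e e0; exists set0, (fun=> 0), (fun=> 0); split=> //.
by rewrite esum_set0 lee_fin ltW.
Qed.

Lemma lebesgue_nullU (R : realType) n (E F : set 'rV[R]_n) :
  lebesgue_null E -> lebesgue_null F -> lebesgue_null (E `|` F).
Proof.
move=> E0 F0 e e0; have e20 : 0 < e / 2 by rewrite divr_gt0.
have [J [a [b [ab Eab leE]]]] := E0 _ e20.
have [K [c [d [cd Fcd leF]]]] := F0 _ e20.
pose a' k := if odd k then c k./2 else a k./2.
pose b' k := if odd k then d k./2 else b k./2.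
pose od k := k.*2.+1.
have a'E k : a' k.*2 = a k by rewrite /a' odd_double doubleK.
have b'E k : b' k.*2 = b k by rewrite /b' odd_double doubleK.
have a'O k : a' (od k) = c k by rewrite /a' /od /= odd_double /= uphalf_double.
have b'O k : b' (od k) = d k by rewrite /b' /od /= odd_double /= uphalf_double.
have ab' k i : a' k 0 i <= b' k 0 i by rewrite /a' /b'; case: ifP.
exists ([set k | odd k /\ K k./2] `|` [set k | ~~ odd k /\ J k./2]), a', b'.
split=> //.
- move=> t [/Eab|/Fcd] [k Jk /= tk].
    by exists k.*2; [right => /=; rewrite odd_double doubleK|rewrite /= a'E b'E].
  by exists (od k); [left; rewrite /= odd_double /= uphalf_double
                    |rewrite /= a'O b'O].
have F0' k : (0 <= (\prod_(i < n) (b' k 0 i - a' k 0 i))%:E)%E.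
  by rewrite lee_fin; apply: prodr_ge0 => i _; rewrite subr_ge0.
have dd k : (odd k.*2 = false) * (k.*2./2 = k) by rewrite odd_double doubleK.
have dS k : (odd (od k) = true) * ((od k)./2 = k).
  by rewrite /od /= odd_double uphalf_double.
rewrite (esumID [set k | odd k]); last by move=> k _; exact: F0'.
rewrite (_ : _ `&` _ = od @` K); last first.
  apply/seteqP; split=> [k [h /= ok]|_ [j Kj <-]].
    case: h => /= -[]; last by rewrite ok.
    by move=> _ Kk; exists k./2 => //; rewrite /od -[RHS]odd_double_half ok.
  by split; [left; rewrite /mkset !dS|rewrite /mkset dS].
rewrite (_ : _ `&` ~` _ = double @` J); last first.
  apply/seteqP; split=> [k [h /= /negP ok]|_ [j Jj <-]].
    case: h => /= -[]; first by rewrite (negbTE ok).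
    by move=> _ Jk; exists k./2 => //; rewrite -[RHS]odd_double_half (negbTE ok).
  by split; [right; rewrite /mkset !dd|rewrite /setC /mkset dd].
rewrite !esum_image.
- under eq_esum do rewrite a'O b'O.
  under [X in (_ + X)%E]eq_esum do rewrite a'E b'E.
  by rewrite [e]splitr EFinD leeD.
- by move=> x y _ _; exact: double_inj.
- by move=> x y _ _ [] /double_inj.
Qed.

Section Chains.
Variables (R : realType) (m : nat).

(* Chains are handled through the finite formal sums representing them; two
   formal sums represent the same chain when they are related by [chain_eqv].
   Every notion below depends only on the chain represented. *)
Definition fsum (n : nat) := seq (R * simplex R m n).

Definition fadd (n : nat) (S T : fsum n) : fsum n := S ++ T.

Definition fscale (n : nat) (c : R) (S : fsum n) : fsum n :=
  [seq (c * u.1, u.2) | u <- S].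

Definition fbd (n : nat) (S : fsum n.+1) : fsum n :=
  flatten [seq map (fun i : 'I_n.+2 => ((-1) ^+ i * u.1, row' i u.2))
                   (enum 'I_n.+2) | u <- S].

(* An oriented affine n-plane is given by an affine frame: a point [p] and a
   row-free matrix [B].  The map t |-> p + t *m B identifies it with R^n and
   transports the Lebesgue null sets and the orientation of R^n. *)
Definition plane_pt (n : nat) (p : 'rV[R]_m) (B : 'M[R]_(n, m)) (t : 'rV[R]_n) :
  'rV[R]_m := p + t *m B.

(* For [s] in the plane, [edges s *m pinvmx B] holds the coordinates of the
   edges of [s] in the frame [B]; the sign is 0 iff [s] is degenerate. *)
Definition orient (n : nat) (B : 'M[R]_(n, m)) (s : simplex R m n) : R :=
  Num.sg (\det (edges s *m pinvmx B)).

(* The function of the part of [S] lying in the plane of frame [(p, B)], read in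
   the coordinates t; [interior] is the topological interior in R^n. *)
Definition chain_fun (n : nat) (p : 'rV[R]_m) (B : 'M[R]_(n, m)) (S : fsum n)
    (t : 'rV[R]_n) : R :=
  \sum_(u <- S | `[< hull u.2 `<=` range (plane_pt p B) >])
    u.1 * orient B u.2 * \1_(interior (plane_pt p B @^-1` hull u.2)) t.

Definition chain_eqv (n : nat) (S T : fsum n) : Prop :=
  forall (p : 'rV[R]_m) (B : 'M[R]_(n, m)), row_free B ->
    lebesgue_null [set t | chain_fun p B S t <> chain_fun p B T t].

(* For n = 0 the exponent [lambda / 0] is 0, so every simplex has weight 1. *)
Definition proj_mass (n : nat) (lambda : R) (f : 'rV[R]_m -> 'rV[R]_m)
    (A : fsum n) : R :=
  inf [set x | exists2 S : fsum n, chain_eqv S A &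
         x = \sum_(u <- S) `|u.1| * volume (simplex_map f u.2) `^ (lambda / n%:R)].

(* The recursion raises n until lambda <= n; [k] bounds the number of steps. *)
Fixpoint natnorm_rec (k : nat) (lambda : R) (n : nat) (A : fsum n) : R :=
  if lambda <= n%:R then
    \sum_(I : {set 'I_m} | #|I| == n) proj_mass lambda (coord_proj I) A
  else if k is k'.+1 then
    \sum_(I : {set 'I_m} | #|I| == n)
      inf [set x | exists C : fsum n.+1,
             x = proj_mass n%:R (coord_proj I) (fadd A (fscale (-1) (fbd C)))
                 + natnorm_rec k' lambda C]
  else 0.

Definition natnorm (lambda : R) (n : nat) (A : fsum n) : R :=
  natnorm_rec (m - n) lambda A.

Lemma natnorm_base (lambda : R) (n : nat) (A : fsum n) : lambda <= n%:R ->
  natnorm lambda A =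
  \sum_(I : {set 'I_m} | #|I| == n) proj_mass lambda (coord_proj I) A.
Proof. by rewrite /natnorm; case: (m - n)%N => [|k] /= ->. Qed.

Lemma natnorm_step (lambda : R) (n : nat) (A : fsum n) :
  n%:R < lambda -> lambda <= m%:R ->
  natnorm lambda A =
  \sum_(I : {set 'I_m} | #|I| == n)
    inf [set x | exists C : fsum n.+1,
           x = proj_mass n%:R (coord_proj I) (fadd A (fscale (-1) (fbd C)))
               + natnorm lambda C].
Proof.
move=> ltnl lelm; have ltnm : (n < m)%N.
  by rewrite -(ltr_nat R); exact: lt_le_trans ltnl lelm.
by rewrite /natnorm subnS -[(m - n)%N]prednK ?subn_gt0//= leNgt ltnl.
Qed.

(* [X], with [iota] sending a formal sum to the class of its chain, is the Banach
   space completion X_{n,lambda} of the space of simplicial n-chains. *)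
Definition is_chain_completion (lambda : R) (n : nat)
    (X : completeNormedModType R) (iota : fsum n -> X) : Prop :=
  [/\ forall S T, iota (fadd S T) = iota S + iota T,
      forall c S, iota (fscale c S) = c *: iota S,
      forall S, `|iota S| = natnorm lambda S
    & dense (range iota)].

End Chains.

(* [natnorm] is a seminorm on formal sums, it depends only on the chain
   represented, and [fbd] is bounded for it: completions and the continuous
   extension of the boundary exist. *)
Section Seminorm.
Variables (R : realType) (m : nat).

Lemma chain_eqv_refl n (S : fsum R m n) : chain_eqv S S.
Proof.
move=> p B _; apply: lebesgue_null_sub (@lebesgue_null0 R n).
by move=> t /=; apply.
Qed.

Lemma chain_eqv_sym n (S T : fsum R m n) : chain_eqv S T -> chain_eqv T S.
Proof.
by move=> e p B rB; apply: lebesgue_null_sub (e p B rB) => t /= /nesym.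
Qed.

Lemma chain_eqv_trans n (S T U : fsum R m n) :
  chain_eqv S T -> chain_eqv T U -> chain_eqv S U.
Proof.
move=> e f p B rB; apply: lebesgue_null_sub (lebesgue_nullU (e p B rB) (f p B rB)).
move=> t /= ne; case: (pselect (chain_fun p B S t = chain_fun p B T t)) => h.
  by right=> h'; apply: ne; rewrite h.
by left.
Qed.

Lemma chain_funD n (S T : fsum R m n) p B t :
  chain_fun p B (fadd S T) t = chain_fun p B S t + chain_fun p B T t.
Proof. by rewrite /chain_fun /fadd big_cat. Qed.

Lemma chain_funZ n c (S : fsum R m n) p B t :
  chain_fun p B (fscale c S) t = c * chain_fun p B S t.
Proof.
rewrite /chain_fun /fscale big_map mulr_sumr.
by apply: eq_bigr => u _; rewrite !mulrA.
Qed.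

Lemma chain_eqvD n (S T S' T' : fsum R m n) :
  chain_eqv S S' -> chain_eqv T T' -> chain_eqv (fadd S T) (fadd S' T').
Proof.
move=> e f p B rB; apply: lebesgue_null_sub (lebesgue_nullU (e p B rB) (f p B rB)).
move=> t /=; rewrite !chain_funD => ne.
case: (pselect (chain_fun p B S t = chain_fun p B S' t)) => h; last by left.
by right=> h'; apply: ne; rewrite h h'.
Qed.

Lemma chain_eqvZ n c (S S' : fsum R m n) :
  chain_eqv S S' -> chain_eqv (fscale c S) (fscale c S').
Proof.
move=> e p B rB; apply: lebesgue_null_sub (e p B rB).
by move=> t /=; rewrite !chain_funZ => ne h; apply: ne; rewrite h.
Qed.

Lemma chain_eqv_fun n (S T : fsum R m n) :
  (forall p B t, chain_fun p B S t = chain_fun p B T t) -> chain_eqv S T.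
Proof.
move=> h p B _; apply: lebesgue_null_sub (@lebesgue_null0 R n).
by move=> t /=; rewrite h.
Qed.

Lemma fbdD n (S T : fsum R m n.+1) : fbd (fadd S T) = fadd (fbd S) (fbd T).
Proof. by rewrite /fbd /fadd map_cat flatten_cat. Qed.

Lemma fbdZ n c (S : fsum R m n.+1) : fbd (fscale c S) = fscale c (fbd S).
Proof.
rewrite /fbd /fscale map_flatten -!map_comp; congr flatten; apply: (@eq_map _ (seq _)) => u /=.
by rewrite -!map_comp; apply: eq_map => i /=; rewrite mulrCA.
Qed.

Let cost n (l : R) f (S : fsum R m n) :=
  \sum_(u <- S) `|u.1| * volume (simplex_map f u.2) `^ (l / n%:R).

Let cost_ge0 n l f (S : fsum R m n) : 0 <= cost l f S.
Proof. by apply: sumr_ge0 => u _; rewrite mulr_ge0// powR_ge0. Qed.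

Let mset_lb n l f (A : fsum R m n) :
  lbound [set x | exists2 S, chain_eqv S A & x = cost l f S] 0.
Proof. by move=> _ [S _ ->]; exact: cost_ge0. Qed.

Lemma proj_mass_le n l f (A S : fsum R m n) : chain_eqv S A ->
  proj_mass l f A <= cost l f S.
Proof. by move=> SA; apply: ge_inf; [exists 0; exact: mset_lb|exists S]. Qed.

Lemma proj_mass_glb n l f (A : fsum R m n) x :
  (forall S, chain_eqv S A -> x <= cost l f S) -> x <= proj_mass l f A.
Proof.
move=> h; apply: lb_le_inf; first by exists (cost l f A), A => //; exact: chain_eqv_refl.
by move=> _ [S SA ->]; exact: h.
Qed.

Lemma proj_mass_ge0 n l f (A : fsum R m n) : 0 <= proj_mass l f A.
Proof. by apply: proj_mass_glb => S _; exact: cost_ge0. Qed.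

Lemma proj_mass_eqv n l f (A A' : fsum R m n) : chain_eqv A A' ->
  proj_mass l f A = proj_mass l f A'.
Proof.
move=> AA'; apply/eqP; rewrite eq_le; apply/andP; split.
  by apply: proj_mass_glb => S h; apply: proj_mass_le (chain_eqv_trans h (chain_eqv_sym AA')).
by apply: proj_mass_glb => S h; apply: proj_mass_le (chain_eqv_trans h AA').
Qed.

Lemma proj_massD n l f (A B : fsum R m n) :
  proj_mass l f (fadd A B) <= proj_mass l f A + proj_mass l f B.
Proof.
rewrite -lerBlDr; apply: proj_mass_glb => S SA.
rewrite lerBlDr addrC -lerBlDr; apply: proj_mass_glb => T TB.
rewrite lerBlDr (le_trans (proj_mass_le _ _ (chain_eqvD SA TB)))//.
by rewrite /cost /fadd big_cat /= addrC.
Qed.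

Lemma proj_massZ n l f c (A : fsum R m n) :
  proj_mass l f (fscale c A) <= `|c| * proj_mass l f A.
Proof.
have costZ S : cost l f (fscale c S) = `|c| * cost l f S.
  rewrite /cost big_map mulr_sumr; apply: eq_bigr => u _ /=.
  by rewrite normrM mulrA.
have [->|c0] := eqVneq c 0.
  rewrite normr0 mul0r; apply: (@le_trans _ _ (cost l f ([::] : fsum R m n))).
    apply: proj_mass_le; apply: chain_eqv_fun => p B t.
    by rewrite chain_funZ mul0r /chain_fun big_nil.
  by rewrite /cost big_nil.
rewrite mulrC -ler_pdivrMr ?normr_gt0//; apply: proj_mass_glb => S SA.
rewrite ler_pdivrMr ?normr_gt0// mulrC -costZ.
exact/proj_mass_le/chain_eqvZ.
Qed.

Let step k l n I (A : fsum R m n) := inf [set x | exists C : fsum R m n.+1,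
  x = proj_mass n%:R (coord_proj I) (fadd A (fscale (-1) (fbd C)))
      + natnorm_rec k l C].

Lemma natnorm_rec_ge0 k l n (A : fsum R m n) : 0 <= natnorm_rec k l A.
Proof.
elim: k n A => [|k IH] n A /=; case: ifP => _ //; try by apply: sumr_ge0 => I _; exact: proj_mass_ge0.
apply: sumr_ge0 => I _; apply: lb_le_inf.
  by eexists; exists [::].
by move=> _ [C ->]; rewrite addr_ge0// proj_mass_ge0.
Qed.

Lemma step_le k l n I (A : fsum R m n) (C : fsum R m n.+1) :
  step k l I A <= proj_mass n%:R (coord_proj I) (fadd A (fscale (-1) (fbd C)))
      + natnorm_rec k l C.
Proof.
apply: ge_inf; last by exists C.
by exists 0 => _ [D ->]; rewrite addr_ge0 ?proj_mass_ge0 ?natnorm_rec_ge0.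
Qed.

Lemma step_glb k l n I (A : fsum R m n) x :
  (forall C : fsum R m n.+1, x <= proj_mass n%:R (coord_proj I) (fadd A (fscale (-1) (fbd C)))
      + natnorm_rec k l C) -> x <= step k l I A.
Proof.
move=> h; apply: lb_le_inf; first by eexists; exists [::].
by move=> _ [C ->]; exact: h.
Qed.

Lemma natnorm_rec_eqv k l n (A B : fsum R m n) : chain_eqv A B ->
  natnorm_rec k l A = natnorm_rec k l B.
Proof.
move=> AB; case: k => [|k] /=; case: ifP => _ //.
- by apply: eq_bigr => I _; exact: proj_mass_eqv.
- by apply: eq_bigr => I _; exact: proj_mass_eqv.
apply: eq_bigr => I _; congr inf; apply/funext => x; apply/propext; split=> -[C ->];
  exists C; congr (_ + _); apply: proj_mass_eqv; apply: chain_eqvD (@chain_eqv_refl _ _) => //.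
exact: chain_eqv_sym.
Qed.

Lemma natnorm_recD k l n (A B : fsum R m n) :
  natnorm_rec k l (fadd A B) <= natnorm_rec k l A + natnorm_rec k l B.
Proof.
elim: k n A B => [|k IH] n A B /=; case: ifP => _; rewrite ?addr0 -?big_split //=.
- by apply: ler_sum => I _; exact: proj_massD.
- by apply: ler_sum => I _; exact: proj_massD.
apply: ler_sum => I _.
rewrite -!/(step _ _ _ _) -lerBlDr; apply: step_glb => C.
rewrite lerBlDr addrC -lerBlDr; apply: step_glb => D.
rewrite lerBlDr (le_trans (step_le k l I _ (fadd C D)))//.
rewrite [leRHS]addrC addrACA; apply: lerD; last exact: IH.
rewrite (le_trans _ (proj_massD _ _ _ _))// le_eqVlt; apply/orP; left; apply/eqP.
apply: proj_mass_eqv; apply: chain_eqv_fun => p Q t.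
by rewrite fbdD !(chain_funD, chain_funZ) mulrDr addrACA.
Qed.

Lemma natnorm_recZ k l n c (A : fsum R m n) :
  natnorm_rec k l (fscale c A) = `|c| * natnorm_rec k l A.
Proof.
have le0 n' d (B : fsum R m n') : natnorm_rec k l (fscale d B) <= `|d| * natnorm_rec k l B.
  elim: k n' d B => [|k' IH] n' d B /=; case: ifP => _; rewrite ?mulr0 ?mulr_sumr //.
  - by apply: ler_sum => I _; exact: proj_massZ.
  - by apply: ler_sum => I _; exact: proj_massZ.
  apply: ler_sum => I _; rewrite -!/(step _ _ _ _).
  have key C : step k' l I (fscale d B) <= `|d| *
     (proj_mass n'%:R (coord_proj I) (fadd B (fscale (-1) (fbd C))) + natnorm_rec k' l C).
    rewrite (le_trans (step_le k' l I _ (fscale d C)))// mulrDr.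
    apply: lerD; last exact: IH.
    rewrite (le_trans _ (proj_massZ _ _ _ _))// le_eqVlt; apply/orP; left; apply/eqP.
    apply: proj_mass_eqv; apply: chain_eqv_fun => p Q t.
    by rewrite fbdZ !(chain_funD, chain_funZ) mulrDr mulrCA.
  have [d0|d0] := eqVneq d 0.
    by have := key [::]; rewrite d0 normr0 !mul0r.
  rewrite mulrC -ler_pdivrMr ?normr_gt0//; apply: step_glb => C.
  by rewrite ler_pdivrMr ?normr_gt0// mulrC.
apply/eqP; rewrite eq_le le0 /=.
have [->|c0] := eqVneq c 0; first by rewrite normr0 mul0r natnorm_rec_ge0.
rewrite -ler_pdivlMl ?normr_gt0// -normfV.
suff /natnorm_rec_eqv <- : chain_eqv (fscale c^-1 (fscale c A)) A by exact: le0.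
by apply: chain_eqv_fun => p B t; rewrite !chain_funZ mulKf.
Qed.

Lemma natnorm_eqv l n (A B : fsum R m n) : chain_eqv A B -> natnorm l A = natnorm l B.
Proof. exact: natnorm_rec_eqv. Qed.

Lemma natnorm_ge0 l n (A : fsum R m n) : 0 <= natnorm l A.
Proof. exact: natnorm_rec_ge0. Qed.

Lemma natnormD l n (A B : fsum R m n) :
  natnorm l (fadd A B) <= natnorm l A + natnorm l B.
Proof. exact: natnorm_recD. Qed.

Lemma natnormZ l n c (A : fsum R m n) : natnorm l (fscale c A) = `|c| * natnorm l A.
Proof. exact: natnorm_recZ. Qed.

Lemma natnorm_fbd l n (A : fsum R m n.+1) : n%:R < l -> l <= m%:R ->
  natnorm l (fbd A) <= 'C(m, n)%:R * natnorm l A.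
Proof.
move=> nl lm; rewrite natnorm_step//.
apply: (@le_trans _ _ (\sum_(I : {set 'I_m} | #|I| == n) natnorm l A)).
  apply: ler_sum => I _; apply: le_trans (_ : proj_mass n%:R (coord_proj I)
      (fadd (fbd A) (fscale (-1) (fbd A))) + natnorm l A <= _).
    apply: ge_inf; last by exists A.
    by exists 0 => _ [C ->]; rewrite addr_ge0 ?proj_mass_ge0 ?natnorm_ge0.
  rewrite gerDr (@proj_mass_eqv _ _ _ _ (fscale 0 [::])); last first.
    apply: chain_eqv_fun => p B t.
    by rewrite chain_funD !chain_funZ mulN1r subrr mul0r.
  by rewrite (le_trans (proj_massZ _ _ _ _))// normr0 mul0r.
by rewrite sumr_const -cardsE card_draws card_ord mulr_natl.
Qed.
End Seminorm.

Section Forms.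
Variables (R : realType) (m : nat).

(* [w x V] is the value at the point [x] on the n rows of [V]. *)
Definition field_of_forms (n : nat) := 'rV[R]_m -> 'M[R]_(n, m) -> R.

Definition is_form (n : nat) (w : field_of_forms n) : Prop :=
  (forall x i a b (U V W : 'M[R]_(n, m)),
     row i U = a *: row i V + b *: row i W ->
     row' i V = row' i U -> row' i W = row' i U ->
     w x U = a * w x V + b * w x W) /\
  (forall x (U : 'M[R]_(n, m)) i j, i != j -> row i U = row j U -> w x U = 0).

(* The coefficient w(e_{I 0}, ..., e_{I (n-1)}). *)
Definition coef (n : nat) (w : field_of_forms n) (I : 'I_n -> 'I_m)
    (x : 'rV[R]_m) : R := w x (\matrix_i delta_mx 0 (I i)).

(* d(f dx_I) = df /\ dx_I, evaluated on constant vector fields. *)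
Definition dform (n : nat) (w : field_of_forms n) : field_of_forms n.+1 :=
  fun x V =>
    \sum_(i < n.+1) (-1) ^+ i * 'D_(row i V) (fun y => w y (row' i V)) x.

Definition pders (s : seq 'I_m) (f : 'rV[R]_m -> R) : 'rV[R]_m -> R :=
  foldr (fun j g => fun x => 'D_(delta_mx 0 j : 'rV[R]_m) g x) f s.

Definition class_C (k : nat) (alpha : R) (f : 'rV[R]_m -> R) : Prop :=
  [/\ forall s, (size s < k)%N -> forall j x,
        derivable (pders s f) x (delta_mx 0 j : 'rV[R]_m),
      forall s, (size s <= k)%N -> continuous (pders s f),
      forall s, (size s <= k)%N -> exists M : R, forall x, `|pders s f x| <= M
    & 0 < alpha -> forall s, size s = k ->
        exists M : R, forall x y,
          `|pders s f x - pders s f y| <= M * `|x - y| `^ alpha].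

Definition form_class_C (r : R) (n : nat) (w : field_of_forms n) : Prop :=
  exists (k : nat) (alpha : R),
    [/\ r = k%:R + alpha, 0 <= alpha < 1
      & forall I : 'I_n -> 'I_m, class_C k alpha (coef w I)].

(* Integral over the simplex {t | 0 <= t_i, t_0 + ... + t_(n-1) <= c}, as an
   iterated integral. *)
Fixpoint stdsimplex_int (n : nat) (c : R) : ('rV[R]_n -> R) -> R :=
  match n with
  | 0 => fun g => g 0
  | n'.+1 => fun g =>
      \int[lebesgue_measure]_(x in `[0, c])
        stdsimplex_int (c - x)
          (fun t : 'rV[R]_n' => g (row_mx (x%:M : 'rV[R]_1) t))
  end.

(* Pull-back along the affine parametrization t |-> p_0 + sum_i t_i (p_i - p_0). *)
Definition simplex_int (n : nat) (w : field_of_forms n) (s : simplex R m n) : R :=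
  stdsimplex_int 1 (fun t => w (row ord0 s + t *m edges s) (edges s)).

Definition fsum_int (n : nat) (w : field_of_forms n) (S : fsum R m n) : R :=
  \sum_(u <- S) u.1 * simplex_int w u.2.

(* [L] is the bounded linear functional on the completion [X] that extends
   integration of [w] over simplicial chains, so that [L A] is the integral of
   [w] over [A]; by density there is at most one such [L]. *)
Definition is_integral (n : nat) (X : completeNormedModType R)
    (iota : fsum R m n -> X) (w : field_of_forms n) (L : {linear X -> R^o}) :
  Prop := continuous L /\ forall S, L (iota S) = fsum_int w S.

(* [D] is the continuous linear extension of the simplicial boundary. *)
Definition is_boundary (n : nat) (X Y : completeNormedModType R)
    (iX : fsum R m n.+1 -> X) (iY : fsum R m n -> Y) (D : {linear X -> Y}) :
  Prop := continuous D /\ forall S, D (iX S) = iY (fbd S).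

End Forms.

(* Main.v *)
(* By density and continuity it suffices to prove Stokes' theorem for a single
   simplex and a form with continuously differentiable coefficients.  Pulled back
   to the standard simplex, d omega is an alternating sum of partial derivatives
   in the directions of the edges.  Integrating the i-th one along its own
   coordinate (which Fubini on a triangle allows) leaves the face t_i = 0 and the
   slanted face sum t_j = 1.  The integral over the slanted face does not depend on
   the coordinate that was eliminated, so the slanted contributions add up to the
   integral of sum_i (-1)^i omega(.., e_i omitted, ..), and by multilinearity and
   alternation this is omega evaluated at the edges e_j - e_0 of that face. *)

Require Import Defs.
From HB Require Import structures.
From mathcomp Require Import all_boot all_order all_algebra.
From mathcomp Require Import fingroup perm.
From mathcomp Require Import all_classical all_reals all_analysis.
From mathcomp Require Import measurable_realfun lra.
Import Order.TTheory GRing.Theory Num.Theory.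
Import numFieldNormedType.Exports.
Local Open Scope classical_set_scope.
Local Open Scope ring_scope.

Section Continuity.

Lemma continuousT_comp (S T U : topologicalType) (f : S -> T) (g : T -> U) :
  continuous f -> continuous g -> continuous (fun x => g (f x)).
Proof. by move=> cf cg x; apply: continuous_comp; [exact: cf|exact: cg]. Qed.

Lemma continuousT_pair (S T U : topologicalType) (f : S -> T) (g : S -> U) :
  continuous f -> continuous g -> continuous (fun x => (f x, g x)).
Proof. by move=> cf cg x; apply: cvg_pair; [exact: cf|exact: cg]. Qed.

Lemma continuousT_fst (S T U : topologicalType) (f : S -> T * U) :
  continuous f -> continuous (fun x => (f x).1).
Proof. by move=> /continuousT_comp; apply => x; exact: cvg_fst. Qed.

Lemma continuousT_snd (S T U : topologicalType) (f : S -> T * U) :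
  continuous f -> continuous (fun x => (f x).2).
Proof. by move=> /continuousT_comp; apply => x; exact: cvg_snd. Qed.

Lemma continuousT_id (S : topologicalType) : continuous (fun x : S => x).
Proof. by move=> x; exact: cvg_id. Qed.

Lemma continuousT_cst (S T : topologicalType) (a : T) :
  continuous (fun _ : S => a).
Proof. by move=> x; exact: cvg_cst. Qed.

Lemma continuousT_add (R : realType) (S : topologicalType) (f g : S -> R) :
  continuous f -> continuous g -> continuous (fun x => f x + g x).
Proof. by move=> cf cg x; apply: continuousD; [exact: cf|exact: cg]. Qed.

Lemma continuousT_sub (R : realType) (S : topologicalType) (f g : S -> R) :
  continuous f -> continuous g -> continuous (fun x => f x - g x).
Proof. by move=> cf cg x; apply: continuousB; [exact: cf|exact: cg]. Qed.

Lemma continuousT_mul (R : realType) (S : topologicalType) (f g : S -> R) :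
  continuous f -> continuous g -> continuous (fun x => f x * g x).
Proof. by move=> cf cg x; apply: continuousM; [exact: cf|exact: cg]. Qed.

Lemma continuousT_sum (R : realType) (S : topologicalType) (I : Type)
    (r : seq I) (f : I -> S -> R) :
  (forall i, continuous (f i)) -> continuous (fun x => \sum_(i <- r) f i x).
Proof.
move=> cf; elim: r => [|i r IH].
  by under eq_fun do rewrite big_nil; exact: continuousT_cst.
by under eq_fun do rewrite big_cons; exact: continuousT_add.
Qed.

End Continuity.

Section OneDim.
Variable R : realType.
Implicit Types (f F : R -> R) (a b c : R).
Notation mu := (@lebesgue_measure R).

Lemma continuous_integrable_itv f a b :
  continuous f -> mu.-integrable `[a, b] (EFin \o f).
Proof.
move=> cf; apply: continuous_compact_integrable; first exact: segment_compact.
exact: continuous_subspaceT.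
Qed.

Lemma Rintegral_itv_le0 f c : c <= 0 -> \int[mu]_(x in `[0, c]) f x = 0.
Proof.
rewrite le_eqVlt => /predU1P[->|c0]; first by rewrite set_itv1 Rintegral_set1.
by rewrite set_itv_ge ?Rintegral_set0// bnd_simp -ltNge.
Qed.

Lemma Rintegral_FTC f F c : 0 <= c -> continuous f ->
  (forall x, is_derive x (1 : R) F (f x)) ->
  \int[mu]_(x in `[0, c]) f x = F c - F 0.
Proof.
rewrite le_eqVlt => /predU1P[<- _ _|c0 cf dF].
  by rewrite Rintegral_itv_le0// subrr.
have cF : continuous F.
  move=> x; apply: differentiable_continuous; apply/derivable1_diffP.
  exact: (@ex_derive _ _ _ _ _ _ _ (dF x)).
rewrite /Rintegral (@continuous_FTC2 _ f F)//.
- exact: continuous_subspaceT.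
- split; first by move=> x _; exact: (@ex_derive _ _ _ _ _ _ _ (dF x)).
  + exact/cvg_at_right_filter/cF.
  + exact/cvg_at_left_filter/cF.
- by move=> x _; rewrite derive1E (@derive_val _ _ _ _ _ _ _ (dF x)).
Qed.

Lemma Rintegral_reflect f c : continuous f ->
  \int[mu]_(x in `[0, c]) f x = \int[mu]_(x in `[0, c]) f (c - x).
Proof.
move=> cf; have [c0|c0] := leP c 0; first by rewrite !Rintegral_itv_le0.
have D : derive1 (fun x : R => c - x) = cst (-1).
  by apply/funext => x; rewrite derive1E deriveB// derive_cst sub0r derive_id.
have cc : continuous (fun x : R => c - x).
  by move=> x; apply: continuousB; [exact: cst_continuous|exact: cvg_id].
have := @integration_by_substitution_decreasing R (fun x => c - x) f 0 c.
rewrite /Rintegral subr0 subrr D => ->//.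
- by congr fine; apply: eq_integral => x _; rewrite /= !fctE/= opprK mulr1.
- exact: ltW.
- by move=> x y _ _ yx; rewrite ltrD2l ltrN2.
- by move=> x _; exact: cst_continuous.
- exact: is_cvg_cst.
- exact: is_cvg_cst.
- split; first by move=> x _; exact: derivableB.
  + exact/cvg_at_right_filter/cc.
  + exact/cvg_at_left_filter/cc.
- exact: continuous_subspaceT.
Qed.

Lemma Rintegral_rescale f c : continuous f ->
  \int[mu]_(x in `[0, c]) f x =
  Num.max c 0 * \int[mu]_(x in `[0, 1]) f (Num.max c 0 * x).
Proof.
move=> cf; have [c0|c0] := leP c 0; first by rewrite mul0r Rintegral_itv_le0.
have cc : continuous (fun x : R => c * x) by exact: mulrl_continuous.
have D : derive1 (fun x : R => c * x) = cst c.
  apply/funext => x; rewrite derive1E (@deriveMl _ _ id)// derive_id.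
  exact: mulr1.
rewrite -RintegralZl//; last first.
  by apply: continuous_integrable_itv => x; apply: continuous_comp; [exact: cc|exact: cf].
have := @integration_by_substitution_increasing R (fun x => c * x) f 0 1.
rewrite /Rintegral mulr0 mulr1 D => ->//.
- by congr fine; apply: eq_integral => x _; rewrite /= !fctE/= mulrC.
- by move=> x y _ _ yx; rewrite ltr_pM2l.
- by move=> x _; exact: cst_continuous.
- exact: is_cvg_cst.
- exact: is_cvg_cst.
- split; first by move=> x _; exact: derivableM.
  + exact/cvg_at_right_filter/cc.
  + exact/cvg_at_left_filter/cc.
- exact: continuous_subspaceT.
Qed.

Lemma continuous_Rintegral_fixed (P : topologicalType) (G : P * R -> R) :
  continuous G -> continuous (fun p => \int[mu]_(x in `[0, 1]) G (p, x)).
Proof.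
move=> cG p0.
have cGp p : continuous (fun x => G (p, x)).
  by apply: continuousT_comp cG; apply: continuousT_pair;
    [exact: continuousT_cst|exact: continuousT_id].
apply/cvgrPdist_le => e e0.
have /compact_near_coveringP/(_ P (nbhs p0) (fun p x => `|G (p0, x) - G (p, x)| <= e)) :=
  @segment_compact R 0 1.
move=> /(_ _ _)/filterS; apply; last first.
  move=> x _.
  have e20 : 0 < e / 2 by rewrite divr_gt0.
  have /cvgrPdist_le/(_ _ e20) := cG (p0, x).
  move=> [[/= A B] [nA nB] AB].
  exists (B, A) => //= -[y p] /= [By Ap].
  have h1 := AB (p, y) (conj Ap By); have h2 := AB (p0, y) (conj (nbhs_singleton nA) By).
  rewrite (le_trans (ler_distD (G (p0, x)) _ _))//= (splitr e) lerD//.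
  by rewrite distrC.
move=> p /= h.
rewrite -RintegralB//; [|exact: continuous_integrable_itv..].
have cD : continuous (fun x => G (p0, x) - G (p, x)).
  by move=> x; apply: continuousB; exact: cGp.
rewrite (le_trans (le_normr_Rintegral _ _))//; first exact: continuous_integrable_itv.
apply: (@le_trans _ _ (\int[mu]_(x in `[0, 1]) cst e x)).
  apply: le_Rintegral => //.
  - apply: (@continuous_integrable_itv (fun x => `|G (p0, x) - G (p, x)|)).
    exact: (@continuousT_comp _ _ _ _ (fun z : R => `|z|) cD (@norm_continuous _ R^o)).
  - by apply: continuous_integrable_itv; exact: cst_continuous.
have mu01 := @lebesgue_measure_itv R `[0, 1].
rewrite /= lte_fin ltr01 oppr0 adde0 in mu01.
rewrite Rintegral_cst// (_ : fine _ = fine 1%E) ?mulr1//; congr fine; exact: mu01.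
Qed.

Lemma continuous_Rintegral_var (P : topologicalType) (c : P -> R) (G : P * R -> R) :
  continuous c -> continuous G ->
  continuous (fun p => \int[mu]_(x in `[0, c p]) G (p, x)).
Proof.
move=> cc cG.
pose m p := Num.max (c p) 0.
have cm : continuous m.
  by move=> p; apply: continuous_max; [exact: cc|exact: cst_continuous].
have -> : (fun p => \int[mu]_(x in `[0, c p]) G (p, x)) =
    (fun p => m p * \int[mu]_(x in `[0, 1]) G (p, m p * x)).
  apply/funext => p; rewrite -(@Rintegral_rescale (fun x => G (p, x)))//.
  by apply: continuousT_comp cG; apply: continuousT_pair;
    [exact: continuousT_cst|exact: continuousT_id].
apply: continuousT_mul => //.
apply: (@continuous_Rintegral_fixed P (fun z => G (z.1, m z.1 * z.2))).
apply: continuousT_comp cG; apply: continuousT_pair.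
  exact/continuousT_fst/continuousT_id.
apply: continuousT_mul; last exact/continuousT_snd/continuousT_id.
by apply: continuousT_comp cm; exact/continuousT_fst/continuousT_id.
Qed.

End OneDim.

Section Triangle.
Variable R : realType.
Implicit Types (h : R * R -> R) (c : R).
Notation mu := (@lebesgue_measure R).

Lemma open_measurable_prod (U : set (R * R)) :
  open U -> measurable (U : set (measurableTypeR R * measurableTypeR R)).
Proof.
move=> oU.
pose B (q : rat * rat * rat) : set (R * R) :=
  ball (ratr q.1.1 : R) (ratr q.2) `*` ball (ratr q.1.2 : R) (ratr q.2).
have -> : U = \bigcup_q (if `[< B q `<=` U >] then B q else set0).
  apply/seteqP; split=> [[x y] Uxy|z [q _]]; last by case: ifPn => // /asboolP; apply.
  have /nbhs_ballP[e /= e0 eU] : nbhs (x, y) U by exact: open_nbhs_nbhs.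
  have e20 : 0 < e / 2 by rewrite divr_gt0.
  have [r /itvP rP] := rat_in_itvoo e20.
  have r0 : 0 < ratr r :> R by rewrite rP.
  have near_rat (t : R) : exists q : rat, ball (ratr q : R) (ratr r) t.
    have tr : t - ratr r < t + ratr r by rewrite ltrD2l (lt_trans _ r0)// oppr_lt0.
    have [q] := rat_in_itvoo tr; rewrite in_itv/= => /andP[q1 q2].
    by exists q; rewrite -ball_normE/= ltr_norml; apply/andP; split; lra.
  have [a ax] := near_rat x; have [b bY] := near_rat y.
  exists (a, b, r) => //=.
  rewrite ifT//; apply/asboolP => -[u v] [/= ua vb]; apply: eU.
  have re : ratr r + ratr r <= e by rewrite [e]splitr lerD// rP.
  split=> /=; apply: (le_ball re); apply: ball_triangle.
  - exact/ball_sym/ax.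
  - exact: ua.
  - exact/ball_sym/bY.
  - exact: vb.
apply: countable_bigcupT_measurable => // q; case: ifP => // _.
apply: measurableX; apply: open_measurable; exact: ball_open.
Qed.

Definition triangle c : set (R * R) :=
  [set z | [/\ 0 <= z.1, 0 <= z.2 & z.1 + z.2 <= c]].

Lemma triangle_restrict_integral h c : continuous h ->
  (\int[mu]_x \int[mu]_y ((h \_ (triangle c)) (x, y))%:E)%E =
  (\int[mu]_(x in `[0, c]) \int[mu]_(y in `[0, c - x]) h (x, y))%:E.
Proof.
move=> ch.
have chx x : continuous (fun y => h (x, y)).
  by apply: continuousT_comp ch; apply: continuousT_pair;
    [exact: continuousT_cst|exact: continuousT_id].
have cI : continuous (fun x => \int[mu]_(y in `[0, c - x]) h (x, y)).
  apply: continuous_Rintegral_var ch.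
  by apply: continuousT_sub; [exact: continuousT_cst|exact: continuousT_id].
rewrite [RHS]fineK; last by apply: integrable_fin_num => //; exact: continuous_integrable_itv.
rewrite [RHS]integral_mkcond; apply: eq_integral => x _.
rewrite patchE; case: ifPn => [|xc].
  rewrite inE /= in_itv/= => /andP[x0 xc].
  rewrite fineK; last by apply: integrable_fin_num => //; exact: continuous_integrable_itv.
  rewrite [RHS]integral_mkcond; apply: eq_integral => y _.
  rewrite !patchE; case: ifPn => [|yc].
    rewrite inE => -[/= _ y0 xy]; rewrite ifT// inE /= in_itv/= y0/=; lra.
  rewrite ifF//; apply/negP; rewrite inE /= in_itv/= => /andP[y0 yx].
  by move/negP: yc; apply; rewrite inE; split=> //=; lra.
apply: integral0_eq => y _; rewrite patchE ifF//.
apply/negP; rewrite inE => -[/= x0 y0 xy]; move/negP: xc; apply.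
by rewrite inE/= in_itv/= x0/=; lra.
Qed.

Lemma Rintegral_triangle_swap h c : continuous h ->
  \int[mu]_(x in `[0, c]) \int[mu]_(y in `[0, c - x]) h (x, y) =
  \int[mu]_(y in `[0, c]) \int[mu]_(x in `[0, c - y]) h (x, y).
Proof.
move=> ch; apply: EFin_inj; rewrite -triangle_restrict_integral//.
have cs : continuous (fun z : R * R => h (z.2, z.1)).
  apply: continuousT_comp ch; apply: continuousT_pair.
    exact/continuousT_snd/continuousT_id.
  exact/continuousT_fst/continuousT_id.
rewrite -(@triangle_restrict_integral (fun z => h (z.2, z.1)))//.
have mT : measurable (triangle c : set (measurableTypeR R * measurableTypeR R)).
  rewrite -[triangle c]setCK; apply: measurableC; apply: open_measurable_prod.
  apply: closed_openC; have -> : triangle c = [set z : R * R | 0 <= z.1] `&`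
    [set z | 0 <= z.2] `&` [set z | 0 <= c - (z.1 + z.2)].
    by apply/seteqP; split=> z /= ; rewrite subr_ge0; [case|case=> -[]].
  have cl (f : R * R -> R) : continuous f -> closed [set z | 0 <= f z].
    by move=> cf; apply: (@closed_comp _ _ f [set x | 0 <= x]) => [z _|];
      [exact: cf|exact: closed_ge].
  have c1 : continuous (fun z : R * R => z.1) by exact/continuousT_fst/continuousT_id.
  have c2 : continuous (fun z : R * R => z.2) by exact/continuousT_snd/continuousT_id.
  apply: closedI; first by apply: closedI; exact: cl.
  by apply: cl; apply: continuousT_sub; [exact: continuousT_cst|exact: continuousT_add].
have Tsub : triangle c `<=` `[0, c] `*` `[0, c].
  by move=> [x y] [/= x0 y0 xy]; rewrite !in_itv/= x0 y0/=; split; lra.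
have mh : measurable_fun setT (h : measurableTypeR R * measurableTypeR R -> measurableTypeR R).
  apply: (measurability _ (RGenOpens.measurableE R)).
  move=> _ [_ [a [b ->] <-]]; rewrite setTI; apply: open_measurable_prod.
  by move/continuousP : ch; apply; exact: interval_open.
have ih : (mu \x mu)%E.-integrable setT (EFin \o (h \_ (triangle c))).
  rewrite -restrict_EFin; apply/(integrable_mkcond _ mT).
  apply: measurable_bounded_integrable => //.
  - apply: (@le_lt_trans _ _ ((mu \x mu)%E (`[0, c] `*` `[0, c]))).
      by apply: le_measure => //; rewrite inE//; exact: measurableX.
    have muc : (mu `[0%R, c] < +oo)%E.
      by apply: compact_finite_measure; exact: segment_compact.
    rewrite product_measure1E//; apply: lte_mul_pinfty => //.
    by rewrite ge0_fin_numE.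
  - exact: measurable_funTS.
  - have : compact (h @` (`[0, c] `*` `[0, c])).
      apply: continuous_compact; first exact: continuous_subspaceT.
      by apply: compact_setX; exact: segment_compact.
    move=> /compact_bounded[M [Mr Mh]]; exists M; split=> // N MN z Tz.
    by apply: Mh => //; exists z => //; exact: Tsub.
have := @Fubini _ _ _ _ _ mu mu _ ih => /= ->.
apply: eq_integral => y _; apply: eq_integral => x _; rewrite !patchE/=.
congr ((if _ then _ else _)%:E); apply/idP/idP; rewrite !inE => -[/= ? ? ?];
  by split=> //=; rewrite addrC.
Qed.

End Triangle.

Section SimplexIntegral.
Variable R : realType.
Notation mu := (@lebesgue_measure R).

Lemma continuousT_row (S : topologicalType) n (F : S -> 'rV[R]_n) :
  (forall i, continuous (fun p => F p 0 i)) -> continuous F.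
Proof.
move=> cF p A [/= P PA sA].
have : \forall q \near p, forall i : 'I_n, P 0 i (F q 0 i).
  by apply: filter_forall => i; exact: (cF i p).
by apply: filterS => q Pq; apply: sA => i j; rewrite ord1.
Qed.

Lemma continuousT_coord (S : topologicalType) n (F : S -> 'rV[R]_n) i :
  continuous F -> continuous (fun p => F p 0 i).
Proof.
move=> cF; apply: (@continuousT_comp _ _ _ F (fun v : 'rV[R]_n => v 0 i) cF).
exact: coord_continuous.
Qed.

Definition row_ins {n} (i : 'I_n.+1) (x : R) (t : 'rV[R]_n) : 'rV[R]_n.+1 :=
  \row_j oapp (fun k => t 0 k) x (unlift i j).

Lemma row_ins_eq n (i : 'I_n.+1) x t : row_ins i x t 0 i = x.
Proof. by rewrite mxE unlift_none. Qed.

Lemma row_ins_lift n (i : 'I_n.+1) x t j : row_ins i x t 0 (lift i j) = t 0 j.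
Proof. by rewrite mxE liftK. Qed.

Lemma row_ins_row_ins n (i : 'I_n.+1) x y t :
  row_ins (lift ord0 i) x (row_ins ord0 y t) = row_ins ord0 y (row_ins i x t).
Proof.
apply/rowP => k; have [j ->|->] := unliftP (lift ord0 i) k.
  rewrite row_ins_lift; have [l ->|->] := unliftP ord0 j.
    have -> : lift (lift ord0 i) (lift ord0 l) = lift ord0 (lift i l).
      by apply: val_inj; rewrite /= /bump /= !add1n ltnS addnS.
    by rewrite !row_ins_lift.
  have -> : lift (lift ord0 i) ord0 = ord0 by apply: val_inj.
  by rewrite !row_ins_eq.
by rewrite row_ins_eq row_ins_lift row_ins_eq.
Qed.

Lemma sum_row_ins n (i : 'I_n.+1) x t :
  \sum_j row_ins i x t 0 j = x + \sum_j t 0 j.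
Proof.
by rewrite (bigD1_ord i)//= row_ins_eq; under eq_bigr do rewrite row_ins_lift.
Qed.

Lemma continuousT_row_ins (S : topologicalType) n i (f : S -> R) (F : S -> 'rV[R]_n) :
  continuous f -> continuous F -> continuous (fun p => row_ins i (f p) (F p)).
Proof.
move=> cf cF; apply: continuousT_row => j.
under eq_fun do rewrite mxE.
by case: unlift => [k|] //=; exact: continuousT_coord.
Qed.

Lemma stdsimplex_intS n c (g : 'rV[R]_n.+1 -> R) :
  stdsimplex_int c g = \int[mu]_(x in `[0, c])
    stdsimplex_int (c - x) (fun t => g (row_ins ord0 x t)).
Proof.
apply: eq_Rintegral => x _; congr (stdsimplex_int _ _).
apply/funext => t; congr g; apply/rowP => j.
rewrite mxE; case: splitP => k jk; rewrite [RHS]mxE.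
  by rewrite ord1 mxE eqxx (_ : j = ord0) ?unlift_none//; apply: val_inj; rewrite /= jk ord1.
by rewrite (_ : j = lift ord0 k) ?liftK//; apply: val_inj.
Qed.

Lemma eq_stdsimplex_int n c (f g : 'rV[R]_n -> R) :
  f =1 g -> stdsimplex_int c f = stdsimplex_int c g.
Proof. by move=> /funext ->. Qed.

Lemma continuous_stdsimplex_int n (S : topologicalType) (c : S -> R)
    (G : S * 'rV[R]_n -> R) :
  continuous c -> continuous G ->
  continuous (fun p => stdsimplex_int (c p) (fun t => G (p, t))).
Proof.
elim: n S c G => [|n IH] S c G cc cG.
  by apply: continuousT_comp cG; apply: continuousT_pair;
    [exact: continuousT_id|exact: continuousT_cst].
under eq_fun do rewrite stdsimplex_intS.
have c1 : continuous (fun z : S * R => z.1) by exact/continuousT_fst/continuousT_id.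
have c2 : continuous (fun z : S * R => z.2) by exact/continuousT_snd/continuousT_id.
apply: (@continuous_Rintegral_var R S c (fun z : S * R =>
  stdsimplex_int (c z.1 - z.2) (fun t => G (z.1, row_ins ord0 z.2 t)))) => //.
apply: (IH (S * R)%type (fun z => c z.1 - z.2)
  (fun w => G (w.1.1, row_ins ord0 w.1.2 w.2))).
  by apply: continuousT_sub => //; apply: continuousT_comp cc.
have d1 : continuous (fun z : S * R * 'rV[R]_n => z.1) by exact/continuousT_fst/continuousT_id.
apply: continuousT_comp cG; apply: continuousT_pair; first exact: continuousT_fst.
apply: continuousT_row_ins; first exact: continuousT_snd.
exact/continuousT_snd/continuousT_id.
Qed.

Lemma continuous_stdsimplex_slice n c (g : 'rV[R]_n.+1 -> R) i :
  continuous g ->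
  continuous (fun x => stdsimplex_int (c - x) (fun t => g (row_ins i x t))).
Proof.
move=> cg; apply: (@continuous_stdsimplex_int n R (fun x => c - x)
  (fun z => g (row_ins i z.1 z.2))).
  by apply: continuousT_sub; [exact: continuousT_cst|exact: continuousT_id].
by apply: continuousT_comp cg; apply: continuousT_row_ins;
  [exact/continuousT_fst/continuousT_id|exact/continuousT_snd/continuousT_id].
Qed.

Lemma continuous_slice n (g : 'rV[R]_n.+1 -> R) i x :
  continuous g -> continuous (fun t => g (row_ins i x t)).
Proof.
by apply: continuousT_comp; apply: continuousT_row_ins;
  [exact: continuousT_cst|exact: continuousT_id].
Qed.

Lemma stdsimplex_intD n c (f g : 'rV[R]_n -> R) :
  continuous f -> continuous g ->
  stdsimplex_int c (fun t => f t + g t) = stdsimplex_int c f + stdsimplex_int c g.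
Proof.
elim: n c f g => [//|n IH] c f g cf cg; rewrite !stdsimplex_intS.
rewrite -RintegralD//; try by apply: continuous_integrable_itv; exact: continuous_stdsimplex_slice.
by apply: eq_Rintegral => x _; rewrite IH//; exact: continuous_slice.
Qed.

Lemma stdsimplex_intZ n c a (f : 'rV[R]_n -> R) :
  continuous f -> stdsimplex_int c (fun t => a * f t) = a * stdsimplex_int c f.
Proof.
elim: n c f => [//|n IH] c f cf; rewrite !stdsimplex_intS.
rewrite -RintegralZl//; last first.
  by apply: continuous_integrable_itv; exact: continuous_stdsimplex_slice.
by apply: eq_Rintegral => x _; rewrite IH//; exact: continuous_slice.
Qed.

Lemma stdsimplex_intB n c (f g : 'rV[R]_n -> R) :
  continuous f -> continuous g ->
  stdsimplex_int c (fun t => f t - g t) = stdsimplex_int c f - stdsimplex_int c g.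
Proof.
move=> cf cg; rewrite -[- stdsimplex_int c g]mulN1r -stdsimplex_intZ// -stdsimplex_intD//.
  by apply: eq_stdsimplex_int => t; rewrite mulN1r.
by apply: continuousT_mul => //; exact: continuousT_cst.
Qed.

Lemma stdsimplex_int_sum n c (I : Type) (r : seq I) (a : I -> R)
    (f : I -> 'rV[R]_n -> R) :
  (forall i, continuous (f i)) ->
  stdsimplex_int c (fun t => \sum_(i <- r) a i * f i t) =
  \sum_(i <- r) a i * stdsimplex_int c (f i).
Proof.
move=> cf.
have caf i : continuous (fun t => a i * f i t).
  by apply: continuousT_mul => //; exact: continuousT_cst.
elim: r => [|i r IH].
  have c0 : continuous (fun _ : 'rV[R]_n => 0 : R) by exact: continuousT_cst.
  rewrite big_nil; transitivity (0 * stdsimplex_int c (fun _ : 'rV[R]_n => 0 : R)).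
    rewrite -stdsimplex_intZ//; apply: eq_stdsimplex_int => t.
    by rewrite big_nil mulr0.
  exact: mul0r.
rewrite big_cons -IH -stdsimplex_intZ// -stdsimplex_intD//; last exact: continuousT_sum.
by apply: eq_stdsimplex_int => t; rewrite big_cons.
Qed.

Lemma stdsimplex_int_swap n c (G : 'rV[R]_n.+2 -> R) : continuous G ->
  stdsimplex_int c G = \int[mu]_(y in `[0, c])
    stdsimplex_int (c - y) (fun t => G (row_ins (lift ord0 ord0) y t)).
Proof.
move=> cG; rewrite stdsimplex_intS.
under eq_Rintegral do rewrite stdsimplex_intS.
under [RHS]eq_Rintegral do rewrite stdsimplex_intS.
rewrite (@Rintegral_triangle_swap R (fun z => stdsimplex_int (c - z.1 - z.2)
  (fun t => G (row_ins ord0 z.1 (row_ins ord0 z.2 t)))))/=.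
  apply: eq_Rintegral => y _; apply: eq_Rintegral => x _.
  by rewrite addrAC; apply: eq_stdsimplex_int => t; rewrite row_ins_row_ins.
have c1 : continuous (fun z : R * R => z.1) by exact/continuousT_fst/continuousT_id.
have c2 : continuous (fun z : R * R => z.2) by exact/continuousT_snd/continuousT_id.
apply: (@continuous_stdsimplex_int _ (R * R)%type (fun z => c - z.1 - z.2)
  (fun w => G (row_ins ord0 w.1.1 (row_ins ord0 w.1.2 w.2)))).
  by do 2 apply: continuousT_sub => //; exact: continuousT_cst.
have d1 : continuous (fun z : R * R * 'rV[R]_n => z.1) by exact/continuousT_fst/continuousT_id.
apply: continuousT_comp cG; apply: continuousT_row_ins; first exact: continuousT_fst.
apply: continuousT_row_ins; first exact: continuousT_snd.
exact/continuousT_snd/continuousT_id.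
Qed.

Lemma stdsimplex_int_FTC n (i : 'I_n.+1) c (g dg : 'rV[R]_n.+1 -> R) :
  0 <= c -> continuous dg ->
  (forall x t, is_derive x (1 : R) (fun y => g (row_ins i y t)) (dg (row_ins i x t))) ->
  stdsimplex_int c dg =
  stdsimplex_int c (fun u => g (row_ins i (c - \sum_j u 0 j) u) - g (row_ins i 0 u)).
Proof.
elim: n i c g dg => [|n IH] i c g dg c0 cdg dgP.
  rewrite stdsimplex_intS /= big_ord0 subr0 (ord1 i).
  apply: (@Rintegral_FTC R (fun x => dg (row_ins ord0 x 0))
    (fun x => g (row_ins ord0 x 0))) => //.
    apply: continuousT_comp cdg; apply: continuousT_row_ins;
      [exact: continuousT_id|exact: continuousT_cst].
  by move=> x; move: (dgP x 0); rewrite (ord1 i).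
have [j ij|i0] := unliftP ord0 i.
  rewrite [LHS]stdsimplex_intS [RHS]stdsimplex_intS; apply: eq_Rintegral => x.
  move=> /set_mem/itvP xc.
  have cx0 : 0 <= c - x by rewrite subr_ge0 xc.
  have dgx y t : is_derive y (1 : R) (fun z => g (row_ins ord0 x (row_ins j z t)))
      (dg (row_ins ord0 x (row_ins j y t))).
    have := dgP y (row_ins ord0 x t); rewrite ij.
    by under eq_fun do rewrite row_ins_row_ins; rewrite row_ins_row_ins.
  have cx := continuous_slice _ _ ord0 x cdg.
  rewrite (IH j (c - x) (fun t => g (row_ins ord0 x t)) _ cx0 cx dgx).
  apply: eq_stdsimplex_int => u; rewrite sum_row_ins ij !row_ins_row_ins.
  by rewrite opprD addrA.
rewrite stdsimplex_int_swap// [RHS]stdsimplex_intS; apply: eq_Rintegral => y.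
move=> /set_mem/itvP yc.
have cy0 : 0 <= c - y by rewrite subr_ge0 yc.
have dgy x t : is_derive x (1 : R)
    (fun z => g (row_ins (lift ord0 ord0) y (row_ins ord0 z t)))
    (dg (row_ins (lift ord0 ord0) y (row_ins ord0 x t))).
  have := dgP x (row_ins ord0 y t); rewrite i0 -row_ins_row_ins.
  by under eq_fun do rewrite -row_ins_row_ins.
have cy := continuous_slice _ _ (lift ord0 ord0) y cdg.
rewrite (IH ord0 (c - y) (fun t => g (row_ins (lift ord0 ord0) y t)) _ cy0 cy dgy).
apply: eq_stdsimplex_int => u; rewrite i0 sum_row_ins !row_ins_row_ins.
by rewrite opprD addrA.
Qed.

(* The vertex [c - sum u] and the coordinate [u_0] trade places: in dimension one
   this is the reflection of the interval. *)
Lemma stdsimplex_int_reflect n c (g : 'rV[R]_n.+2 -> R) : continuous g ->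
  stdsimplex_int c (fun u => g (row_ins (lift ord0 ord0) (c - \sum_j u 0 j) u)) =
  stdsimplex_int c (fun u => g (row_ins ord0 (c - \sum_j u 0 j) u)).
Proof.
have csum k d : continuous (fun u : 'rV[R]_k => d - \sum_j u 0 j).
  apply: continuousT_sub; first exact: continuousT_cst.
  by apply: continuousT_sum => j; exact/continuousT_coord/continuousT_id.
have cface k i (h : 'rV[R]_k.+1 -> R) d : continuous h ->
    continuous (fun u : 'rV[R]_k => h (row_ins i (d - \sum_j u 0 j) u)).
  by move=> ch; apply: continuousT_comp ch; apply: continuousT_row_ins;
    [exact: csum|exact: continuousT_id].
elim: n c g => [|n IH] c g cg.
  rewrite !stdsimplex_intS /=.
  rewrite Rintegral_reflect.
    apply: eq_Rintegral => x _; rewrite !row_ins_row_ins !sum_row_ins big_ord0 !addr0.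
    congr g; congr (row_ins _ _ (row_ins _ _ _)).
    by rewrite opprB addrC subrK.
  apply: (@continuousT_comp R 'rV[R]_1 R (fun x => row_ins ord0 x 0)
    (fun v => g (row_ins (lift ord0 ord0) (c - \sum_j v 0 j) v))).
    by apply: continuousT_row_ins; [exact: continuousT_id|exact: continuousT_cst].
  exact: cface.
rewrite !stdsimplex_int_swap; [|exact: cface|exact: cface].
apply: eq_Rintegral => y _.
have := IH (c - y) (fun t => g (row_ins (lift ord0 (lift ord0 ord0)) y t)).
move=> /(_ (continuous_slice _ _ _ _ cg)) => h.
transitivity (stdsimplex_int (c - y) (fun u => g (row_ins (lift ord0 (lift ord0 ord0)) y
  (row_ins (lift ord0 ord0) (c - y - \sum_j u 0 j) u)))); last rewrite h.
all: rewrite !stdsimplex_intS; apply: eq_Rintegral => x _.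
all: apply: eq_stdsimplex_int => v; congr g; rewrite !(row_ins_row_ins, sum_row_ins).
- by rewrite opprD addrA.
- by rewrite -addrA -opprD [y + (_ + _)]addrCA.
Qed.

Lemma stdsimplex_int_slanted n (i : 'I_n.+1) c (g : 'rV[R]_n.+1 -> R) :
  continuous g ->
  stdsimplex_int c (fun u => g (row_ins i (c - \sum_j u 0 j) u)) =
  stdsimplex_int c (fun u => g (row_ins ord0 (c - \sum_j u 0 j) u)).
Proof.
elim: n i c g => [|n IH] i c g cg; first by rewrite (ord1 i).
have [j ij|->//] := unliftP ord0 i.
rewrite -stdsimplex_int_reflect// !stdsimplex_intS; apply: eq_Rintegral => x _.
have := IH j (c - x) (fun t => g (row_ins ord0 x t)) (continuous_slice _ _ _ _ cg).
rewrite (_ : (fun u => _) = fun t =>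
  g (row_ins i (c - \sum_k row_ins ord0 x t 0 k) (row_ins ord0 x t))); last first.
  by apply/funext => t; rewrite sum_row_ins ij row_ins_row_ins opprD addrA.
move=> ->; apply: eq_stdsimplex_int => t; rewrite sum_row_ins row_ins_row_ins.
by rewrite opprD addrA.
Qed.

End SimplexIntegral.

Arguments row_ins {R n}.

Lemma row_row_perm (T : Type) (m n : nat) (u : 'S_m) (A : 'M[T]_(m, n)) i :
  row i (row_perm u A) = row (u i) A.
Proof. by apply/rowP => j; rewrite !mxE. Qed.

Section AlternatingForms.
Variables (R : realType) (m n : nat) (w : field_of_forms R m n).
Hypothesis wF : is_form w.
Implicit Types (x r s : 'rV[R]_m) (V : 'M[R]_(n, m)) (i j : 'I_n).

Definition set_row V i r : 'M[R]_(n, m) :=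
  \matrix_k (if k == i then r else row k V).

Lemma row_set_row V i r k :
  row k (set_row V i r) = if k == i then r else row k V.
Proof. exact: rowK. Qed.

Lemma set_row_id V i : set_row V i (row i V) = V.
Proof.
by apply/row_matrixP => k; rewrite row_set_row; case: eqP => [->|].
Qed.

Lemma row'_set_row V i r : row' i (set_row V i r) = row' i V.
Proof.
apply/matrixP => k l.
by rewrite !mxE eq_sym (negPf (neq_lift i k)) mxE.
Qed.

Lemma form_set_rowD x V i a b r s :
  w x (set_row V i (a *: r + b *: s)) =
  a * w x (set_row V i r) + b * w x (set_row V i s).
Proof.
by apply: (wF.1 x i); rewrite ?row_set_row ?eqxx// !row'_set_row.
Qed.

Lemma form_set_row_sum x V i (I : Type) (t : seq I) (a : I -> R)
    (r : I -> 'rV[R]_m) :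
  w x (set_row V i (\sum_(k <- t) a k *: r k)) =
  \sum_(k <- t) a k * w x (set_row V i (r k)).
Proof.
elim: t => [|k t IH]; last first.
  by rewrite !big_cons -IH -[\sum_(_ <- t) _]scale1r form_set_rowD mul1r scale1r.
rewrite !big_nil; have := form_set_rowD x V i 0 0 0 0.
by rewrite !scaler0 addr0 !mul0r addr0.
Qed.

Lemma form_tperm x V i j : i != j -> w x (row_perm (tperm i j) V) = - w x V.
Proof.
move=> ij; set p := row i V; set q := row j V.
pose U r s := set_row (set_row V i r) j s.
have UC r s : U r s = set_row (set_row V j s) i r.
  apply/row_matrixP => k; rewrite !row_set_row.
  by case: (eqVneq k i) => // ->; rewrite (negPf ij).
have U0 r : w x (U r r) = 0.
  by apply: (wF.2 x _ i j ij); rewrite !row_set_row !eqxx (negPf ij).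
have UDr r s t : w x (U r (s + t)) = w x (U r s) + w x (U r t).
  by have := form_set_rowD x (set_row V i r) j 1 1 s t; rewrite !scale1r !mul1r.
have UDl r s t : w x (U (r + s) t) = w x (U r t) + w x (U s t).
  rewrite !UC; have := form_set_rowD x (set_row V j t) i 1 1 r s.
  by rewrite !scale1r !mul1r.
have := U0 (p + q); rewrite UDr !UDl !U0 add0r addr0 => /eqP.
rewrite addr_eq0 => /eqP e.
have -> : row_perm (tperm i j) V = U q p.
  apply/row_matrixP => k; rewrite row_row_perm !row_set_row.
  by case: tpermP => [->|->|/eqP/negPf-> /eqP/negPf->]//;
    rewrite eqxx ?(negPf ij).
have -> : V = U p q; last first.
  by rewrite /U {3}/p set_row_id /q set_row_id in e *.
by rewrite /U /p set_row_id /q set_row_id.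
Qed.

Lemma form_perm x V (u : 'S_n) : w x (row_perm u V) = (-1) ^+ u * w x V.
Proof.
have [ts -> dts] := prod_tpermP u.
elim: ts dts => [_|[i j] ts IH /= /andP[ij dts]].
  by rewrite big_nil row_perm1 odd_perm1 mul1r.
rewrite big_cons row_permM form_tperm// IH// odd_mul_tperm ij.
by rewrite addTb signrN mulNr.
Qed.

Lemma form_subr_rows x V r :
  w x (\matrix_i (row i V - r)) = w x V - \sum_i w x (set_row V i r).
Proof.
pose M l := \matrix_i (if (i < l)%N then row i V - r else row i V).
have rowM l i : row i (M l) = if (i < l)%N then row i V - r else row i V.
  exact: rowK.
have MS (i : 'I_n) : M i.+1 = set_row (M i) i (1 *: row i V + -1 *: r).
  apply/row_matrixP => k; rewrite row_set_row !rowM ltnS leq_eqVlt.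
  rewrite -(inj_eq val_inj); case: eqP => [/val_inj->|//] /=.
  by rewrite scale1r scaleN1r.
have Mid (i : 'I_n) : set_row (M i) i (row i V) = M i.
  by rewrite -[in RHS](set_row_id (M i) i) rowM ltnn.
have setM k l : (l <= n)%N -> w x (set_row (M l) k r) = w x (set_row V k r).
  elim: l => [_|l IH ln].
    by congr (w x (set_row _ k r)); apply/row_matrixP => i; rewrite rowM.
  rewrite -IH 1?ltnW//; pose i := Ordinal ln; rewrite -[l]/(val i) MS.
  have [->|ik] := eqVneq i k.
    congr (w x _); apply/row_matrixP => j; rewrite !row_set_row.
    by case: eqP.
  have sC V' r' : set_row (set_row V' i r') k r = set_row (set_row V' k r) i r'.
    apply/row_matrixP => j; rewrite !row_set_row.
    by case: (eqVneq j i) => // ->; rewrite (negPf ik).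
  rewrite sC form_set_rowD (wF.2 x (set_row _ i r) i k ik); last first.
    by rewrite !row_set_row !eqxx eq_sym (negPf ik).
  by rewrite mulr0 addr0 mul1r -sC Mid.
have key l : (l <= n)%N ->
    w x (M l) = w x V - \sum_(i : 'I_n | (i < l)%N) w x (set_row V i r).
  elim: l => [_|l IH ln].
    rewrite big_pred0// subr0; congr (w x _).
    by apply/row_matrixP => i; rewrite rowM.
  pose i := Ordinal ln; rewrite -[l]/(val i) MS form_set_rowD Mid mul1r mulN1r.
  rewrite setM 1?ltnW// IH 1?ltnW// [in RHS](bigD1 i)//= opprD addrA addrAC.
  congr (_ - _ - _); apply: eq_bigl => k.
  by rewrite ltnS [(k <= l)%N]leq_eqVlt -(inj_eq val_inj)/=; case: ltngtP.
have := key n (leqnn _); rewrite (eq_bigl xpredT) => [<-|i]; last exact: ltn_ord.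
by congr (w x _); apply/row_matrixP => i; rewrite rowM rowK ltn_ord.
Qed.

End AlternatingForms.

Arguments set_row {R m n}.

Lemma form_subr_row0 (R : realType) (m n : nat) (w : field_of_forms R m n) x
    (E : 'M[R]_(n.+1, m)) : is_form w ->
  w x (\matrix_i (row (lift ord0 i) E - row ord0 E)) =
  \sum_(i < n.+1) (-1) ^+ i * w x (row' i E).
Proof.
move=> wF; rewrite big_ord_recl /= expr0 mul1r.
transitivity (w x (\matrix_i (row i (row' ord0 E) - row ord0 E))).
  congr (w x _); apply/row_matrixP => i; rewrite !rowK; congr (_ - _).
  by apply/rowP => j; rewrite !mxE.
rewrite form_subr_rows// -sumrN; congr (_ + _); apply: eq_bigr => i _.
rewrite /bump /= add1n exprS mulN1r mulNr; congr (- _).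
case: n w E wF i => [|n] w E wF; first by case.
move=> i; pose u := lift_perm i ord0 1%g.
have -> : set_row (row' ord0 E) i (row ord0 E) =
    row_perm u (row' (lift ord0 i) E).
  apply/row_matrixP => k; rewrite row_row_perm row_set_row.
  have [j ->|->] := unliftP i k.
    rewrite lift_perm_lift perm1 eq_sym (negPf (neq_lift i j)).
    apply/rowP => l; rewrite !mxE; congr (E _ _).
    by apply: val_inj; rewrite /= /bump /= !add1n ltnS addnS.
  rewrite lift_perm_id eqxx; apply/rowP => l; rewrite !mxE.
  by congr (E _ _); apply: val_inj.
by rewrite form_perm// odd_lift_perm odd_perm1 /= !addbF signr_odd.
Qed.

Section ContinuouslyDifferentiable.
Variables (R : realType) (m : nat).
Notation mu := (@lebesgue_measure R).
Implicit Types (f g : 'rV[R]_m -> R) (x y u v : 'rV[R]_m).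

Lemma is_derive_cvgP (V : normedModType R) (f : V -> R) (x v : V) (l : R) :
  is_derive x v f l <->
  (fun h => h^-1 * (f (h *: v + x) - f x)) @ 0^' --> l.
Proof.
split=> [[df <-] //|df]; apply: DeriveDef; first by apply/cvg_ex; exists l.
exact: cvg_lim df.
Qed.

Lemma is_derive_line (V : normedModType R) (f : V -> R) (y v : V) (t l : R) :
  is_derive (t *: v + y) v f l ->
  is_derive t (1 : R) (fun s => f (s *: v + y)) l.
Proof.
move=> /is_derive_cvgP df; apply/is_derive_cvgP.
rewrite [X in X @ _](_ : _ = fun h => h^-1 * (f (h *: v + (t *: v + y)) - f (t *: v + y)))//.
by apply/funext => h; rewrite [_%:A]mulr1 scalerDl addrA.
Qed.

Lemma continuousT_scale_add (S : topologicalType) (a : S -> R) v (F : S -> 'rV[R]_m) :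
  continuous a -> continuous F -> continuous (fun z => a z *: v + F z).
Proof.
move=> ca cF; apply: continuousT_row => i; under eq_fun do rewrite !mxE.
apply: continuousT_add; last exact: continuousT_coord.
by apply: continuousT_mul => //; exact: continuousT_cst.
Qed.

Lemma is_derive_add_partial f x u e (l s : R) (df : 'rV[R]_m -> R) :
  (forall y, is_derive y e f (df y)) -> continuous df ->
  is_derive x u f l -> is_derive x (s *: e + u) f (s * df x + l).
Proof.
move=> dfP cdf /is_derive_cvgP du; apply/is_derive_cvgP.
(* The increment of [f] along [h * s *: e] is [h * s] times the average [Phi h]
   of [df] over that segment, and [Phi] is continuous with [Phi 0 = df x]. *)
pose Phi h := \int[mu]_(t in `[0, 1]) df ((h * s * t) *: e + (h *: u + x)).
have cPhi : continuous Phi.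
  apply: (@continuous_Rintegral_fixed R R
    (fun z => df ((z.1 * s * z.2) *: e + (z.1 *: u + x)))).
  have c1 : continuous (fun z : R * R => z.1) by exact/continuousT_fst/continuousT_id.
  have c2 : continuous (fun z : R * R => z.2) by exact/continuousT_snd/continuousT_id.
  apply: continuousT_comp cdf; apply: continuousT_scale_add.
    by apply: continuousT_mul c2; apply: continuousT_mul => //; exact: continuousT_cst.
  by apply: continuousT_scale_add => //; exact: continuousT_cst.
have Phi0 : Phi 0 = df x.
  rewrite /Phi; under eq_Rintegral do rewrite !mul0r !scale0r !add0r.
  have dl t : is_derive t (1 : R) ( *%R (df x)) (df x).
    by apply: is_derive_eq; rewrite [LHS]mulr1.
  have := @Rintegral_FTC R (cst (df x)) _ 1 ler01 (@continuousT_cst _ _ _) dl.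
  by rewrite mulr1 mulr0 subr0.
have PhiE h : h != 0 ->
    f (h *: (s *: e + u) + x) - f (h *: u + x) = h * s * Phi h.
  move=> h0.
  have cdfh : continuous (fun t => df ((h * s * t) *: e + (h *: u + x))).
    apply: continuousT_comp cdf.
    apply: continuousT_scale_add; last exact: continuousT_cst.
    by apply: continuousT_mul; [exact: continuousT_cst|exact: continuousT_id].
  rewrite /Phi -RintegralZl//; last exact: continuous_integrable_itv.
  have dfh t : is_derive t (1 : R) (fun t => f ((h * s * t) *: e + (h *: u + x)))
      (h * s * df ((h * s * t) *: e + (h *: u + x))).
    rewrite [h * s * df _]mulrC.
    apply: (@is_derive1_comp R (fun r => f (r *: e + (h *: u + x))) ( *%R (h * s))).
      exact: is_derive_line.
    by apply: is_derive_eq; rewrite [LHS]mulr1.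
  have cdfh' : continuous (fun t => h * s * df ((h * s * t) *: e + (h *: u + x))).
    by apply: continuousT_mul => //; exact: continuousT_cst.
  rewrite (@Rintegral_FTC R _ _ 1 ler01 cdfh' dfh).
  by rewrite mulr1 mulr0 scale0r add0r scalerDr scalerA addrA.
have lim : (fun h => s * Phi h + h^-1 * (f (h *: u + x) - f x)) @ 0^' --> s * df x + l.
  apply: cvgD => //; apply: cvgM; first exact: cvg_cst.
  by rewrite -Phi0; apply: cvg_within_filter; exact: cPhi.
apply: cvg_trans lim; apply: near_eq_cvg; near=> h.
have h0 : h != 0 by near: h; exact: nbhs_dnbhs_neq.
rewrite /= -[f (h *: (s *: e + u) + x)](subrK (f (h *: u + x))) PhiE//.
by rewrite -addrA [in RHS]mulrDr -mulrA mulKf.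
Unshelve. all: by end_near. Qed.

Lemma partials_is_derive f (df : 'I_m -> 'rV[R]_m -> R) x v :
  (forall j y, is_derive y (delta_mx 0 j : 'rV[R]_m) f (df j y)) ->
  (forall j, continuous (df j)) ->
  is_derive x v f (\sum_j v 0 j * df j x).
Proof.
move=> dfP cdf; rewrite {1}(row_sum_delta v).
elim: (index_enum _) => [|j r IH]; last first.
  by rewrite !big_cons; apply: is_derive_add_partial.
by rewrite !big_nil; exact: is_derive0.
Qed.

Definition cont_diff f := continuous f /\
  exists2 df : 'I_m -> 'rV[R]_m -> R, forall j, continuous (df j) &
    forall x v, is_derive x v f (\sum_j v 0 j * df j x).

Lemma cont_diff_sum (I : Type) (r : seq I) (a : I -> R) (F : I -> 'rV[R]_m -> R) :
  (forall i, cont_diff (F i)) ->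
  cont_diff (fun x => \sum_(i <- r) a i * F i x).
Proof.
move=> dF; elim: r => [|i r [cS [dS cdS dSP]]].
  under [X in cont_diff X]eq_fun do rewrite big_nil.
  split; first exact: continuousT_cst.
  exists (fun _ _ => 0) => [j|x v]; first exact: continuousT_cst.
  by rewrite big1 => [|j _]; [exact: is_derive_cst|rewrite mulr0].
have [cF [d cd dP]] := dF i.
under [X in cont_diff X]eq_fun do rewrite big_cons.
have cst (b : R) : continuous (fun _ : 'rV[R]_m => b) by exact: continuousT_cst.
split; first by apply: continuousT_add => //; apply: continuousT_mul.
exists (fun j x => a i * d j x + dS j x) => [j|x v].
  by apply: continuousT_add => //; apply: continuousT_mul.
have -> : \sum_j v 0 j * (a i * d j x + dS j x) =
    a i *: (\sum_j v 0 j * d j x) + \sum_j v 0 j * dS j x.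
  rewrite scaler_sumr -big_split; apply: eq_bigr => j _ /=.
  by rewrite mulrDr mulrCA.
exact: (@is_deriveD _ _ _ (a i *: F i) (fun x => \sum_(k <- r) a k * F k x)).
Qed.

Lemma class_C_cont_diff k alpha f : (0 < k)%N -> class_C k alpha f -> cont_diff f.
Proof.
move=> k0 [df cf _ _]; split; first exact: (cf [::]).
exists (fun j => pders [:: j] f) => [j|x v]; first exact: (cf [:: j]).
apply: (partials_is_derive f (fun j => pders [:: j] f)) => [j y|j].
  exact/derivableP/(df [::] k0).
exact: (cf [:: j]).
Qed.

Lemma form_cont_diff n (w : field_of_forms R m n) :
  is_form w -> (forall I, cont_diff (coef w I)) ->
  forall V, cont_diff (fun x => w x V).
Proof.
move=> wF cw.
suff H l : (l <= n)%N -> forall V : 'M[R]_(n, m),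
    (forall i : 'I_n, (l <= i)%N -> exists j, row i V = delta_mx 0 j) ->
    cont_diff (fun x => w x V).
  by move=> V; apply: (H n) => // i; rewrite leqNgt ltn_ord.
elim: l => [_ V hV|l IH ln V hV].
  have [I hI] := choice (fun i => hV i (leq0n i)).
  have -> : V = \matrix_i delta_mx 0 (I i) by apply/row_matrixP => i; rewrite rowK.
  exact: cw.
pose i := Ordinal ln.
have -> : (fun x => w x V) =
    fun x => \sum_j V i j * w x (set_row V i (delta_mx 0 j)).
  apply/funext => x; rewrite -form_set_row_sum// -[V in LHS](set_row_id _ _ _ V i).
  rewrite [in LHS](row_sum_delta (row i V)); congr (w x (set_row V i _)).
  by apply: eq_bigr => j _; rewrite mxE.
apply: cont_diff_sum => j; apply: IH; first exact: ltnW.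
move=> k lk; rewrite row_set_row; case: eqVneq => [_|ki]; first by exists j.
apply: hV; rewrite ltn_neqAle lk andbT; apply: contra_neq ki => lk'.
by apply: val_inj.
Qed.

End ContinuouslyDifferentiable.

Arguments cont_diff {R m}.

Section StokesSimplex.
Variables (R : realType) (m n : nat) (w : field_of_forms R m n).
Hypotheses (wF : is_form w) (wC : forall V, cont_diff (fun x => w x V)).

Lemma row_ins_mulmx (i : 'I_n.+1) y (t : 'rV[R]_n) (E : 'M[R]_(n.+1, m)) :
  row_ins i y t *m E = y *: row i E + t *m row' i E.
Proof.
apply/rowP => j; rewrite !mxE (bigD1_ord i)//= row_ins_eq; congr (_ + _).
by apply: eq_bigr => k _; rewrite row_ins_lift !mxE.
Qed.

Lemma mulmx_subr_rows (u : 'rV[R]_n) (E : 'M[R]_(n.+1, m)) (r : 'rV[R]_m) :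
  u *m \matrix_i (row (lift ord0 i) E - r) =
  u *m row' ord0 E - (\sum_i u 0 i) *: r.
Proof.
apply/rowP => j; rewrite !mxE mulr_suml -sumrB; apply: eq_bigr => k _.
by rewrite !mxE mulrBr.
Qed.

Lemma row0_row'0 (s : simplex R m n.+1) :
  row ord0 (row' ord0 s) = row ord0 s + row ord0 (edges s).
Proof.
apply/rowP => j; rewrite !mxE addrC subrK.
by congr (s _ _); apply: val_inj.
Qed.

Lemma edges_row'0 (s : simplex R m n.+1) :
  edges (row' ord0 s) =
  \matrix_i (row (lift ord0 i) (edges s) - row ord0 (edges s)).
Proof.
apply/matrixP => i j; rewrite !mxE opprB addrA subrK.
by congr (s _ _ - s _ _); apply: val_inj.
Qed.

Lemma row0_row'S (s : simplex R m n.+1) (i : 'I_n.+1) :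
  row ord0 (row' (lift ord0 i) s) = row ord0 s.
Proof.
by apply/rowP => j; rewrite !mxE; congr (s _ _); apply: val_inj.
Qed.

Lemma edges_row'S (s : simplex R m n.+1) (i : 'I_n.+1) :
  edges (row' (lift ord0 i) s) = row' i (edges s).
Proof.
apply/matrixP => k j; rewrite !mxE; congr (s _ _ - s _ _); apply: val_inj.
  by rewrite /= /bump /= !add1n ltnS addnS.
by [].
Qed.

Lemma Stokes_simplex (s : simplex R m n.+1) :
  simplex_int (dform w) s =
  \sum_(i < n.+2) (-1) ^+ i * simplex_int w (row' i s).
Proof.
set E := edges s; set p := row ord0 s.
pose f (i : 'I_n.+1) (t : 'rV[R]_n.+1) := w (p + t *m E) (row' i E).
pose df (i : 'I_n.+1) (t : 'rV[R]_n.+1) :=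
  'D_(row i E) (fun y => w y (row' i E)) (p + t *m E).
have caff : continuous (fun t : 'rV[R]_n.+1 => p + t *m E).
  apply: continuousT_row => j; under eq_fun do rewrite !mxE.
  apply: continuousT_add; first exact: continuousT_cst.
  apply: continuousT_sum => k; apply: continuousT_mul; last exact: continuousT_cst.
  exact/continuousT_coord/continuousT_id.
have cf i : continuous (f i) by apply: (continuousT_comp _ _ _ _ _ caff (wC _).1).
have cdf i : continuous (df i).
  have [_ [d cd dP]] := wC (row' i E).
  have -> : df i = fun t => \sum_j row i E 0 j * d j (p + t *m E).
    by apply/funext => t; exact: (@derive_val _ _ _ _ _ _ _ (dP _ _)).
  apply: continuousT_sum => j; apply: continuousT_mul; first exact: continuousT_cst.
  exact: (continuousT_comp _ _ _ _ _ caff (cd j)).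
have df_row_ins i y t : is_derive y (1 : R) (fun z => f i (row_ins i z t)) (df i (row_ins i y t)).
  have [_ [d _ dP]] := wC (row' i E).
  rewrite /f /df; under eq_fun do rewrite row_ins_mulmx addrCA.
  rewrite row_ins_mulmx addrCA.
  apply: (is_derive_line _ _ (fun y => w y (row' i E))).
  by apply: derivableP; exact: (@ex_derive _ _ _ _ _ _ _ (dP _ _)).
have csum : continuous (fun u : 'rV[R]_n => 1 - \sum_j u 0 j).
  apply: continuousT_sub; first exact: continuousT_cst.
  by apply: continuousT_sum => j; exact/continuousT_coord/continuousT_id.
have cface i j (a : 'rV[R]_n -> R) : continuous a ->
    continuous (fun u => f i (row_ins j (a u) u)).
  move=> ca; apply: (continuousT_comp _ _ _ _ _ _ (cf i)).
  by apply: continuousT_row_ins => //; exact: continuousT_id.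
have c0 : continuous (fun _ : 'rV[R]_n => 0 : R) by exact: continuousT_cst.
rewrite /simplex_int /dform -/E -/p.
rewrite (stdsimplex_int_sum R n.+1 1 _ _ (fun i : 'I_n.+1 => (-1) ^+ i) df)//.
have dfI i := stdsimplex_int_FTC R n i 1 (f i) (df i) ler01 (cdf i) (df_row_ins i).
under eq_bigr => i _.
  rewrite dfI stdsimplex_intB; [|exact: cface|exact: cface].
  rewrite stdsimplex_int_slanted// mulrBr; over.
rewrite sumrB -stdsimplex_int_sum; last by move=> i; exact: cface.
rewrite [RHS]big_ord_recl expr0 mul1r -sumrN; congr (_ + _).
  apply: eq_stdsimplex_int => u.
  rewrite /f row0_row'0 edges_row'0 -/E -/p form_subr_row0//.
  apply: eq_bigr => i _; congr (_ * w _ _).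
  rewrite row_ins_mulmx mulmx_subr_rows scalerBl scale1r -!addrA.
  by congr (_ + (_ + _)); rewrite addrC.
apply: eq_bigr => i _; rewrite /= /bump /= add1n exprS mulN1r mulNr.
rewrite row0_row'S edges_row'S -/E -/p; congr (- (_ * _)).
by apply: eq_stdsimplex_int => u; rewrite /f row_ins_mulmx scale0r add0r.
Qed.

Lemma Stokes_fsum (S : fsum R m n.+1) :
  fsum_int (dform w) S = fsum_int w (fbd S).
Proof.
rewrite /fsum_int /fbd big_flatten big_map; apply: eq_bigr => u _.
rewrite big_map big_enum Stokes_simplex mulr_sumr; apply: eq_bigr => i _ /=.
by rewrite mulrCA mulrA.
Qed.

End StokesSimplex.

Lemma eq_on_dense (R : realType) (T : topologicalType) (D : set T) (f g : T -> R) :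
  dense D -> continuous f -> continuous g -> (forall x, D x -> f x = g x) ->
  f =1 g.
Proof.
move=> dD cf cg fg x; apply/eqP/negPn/negP => /eqP nfg.
have cfg : continuous (fun x => f x - g x) by exact: continuousT_sub.
have oU : open [set y | f y - g y != 0].
  apply: (@open_comp _ _ (fun y => f y - g y) [set z | z != 0]).
    by move=> y _; exact: cfg.
  exact: open_neq.
have [|y [/eqP fgy Dy]] := dD _ _ oU.
  by exists x => /=; rewrite subr_eq0; exact/eqP.
by apply: fgy; rewrite fg// subrr.
Qed.

Theorem theorem2 (R : realType) (m n : nat) (lambda : R)
    (X Y : completeNormedModType R)
    (iX : fsum R m n.+1 -> X) (iY : fsum R m n -> Y)
    (bd : {linear X -> Y}) (omega : field_of_forms R m n)
    (Ld : {linear X -> R^o}) (L : {linear Y -> R^o}) (A : X) :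
  (n.+1 <= m)%N ->
  n.+1%:R <= lambda <= m%:R ->
  is_chain_completion lambda iX ->
  is_chain_completion lambda iY ->
  is_boundary iX iY bd ->
  is_form omega ->
  form_class_C (lambda - n.+1%:R + 1) omega ->
  is_integral iX (dform omega) Ld ->
  is_integral iY omega L ->
  Ld A = L (bd A).
Proof.
move=> _ /andP[nlambda _] [_ _ _ dX] _ [cbd bdE] omegaF [k [alpha [kE alpha01 omegaC]]].
move=> [cLd LdE] [cL LE].
have k0 : (0 < k)%N.
  rewrite lt0n; apply/eqP => k0; move: kE alpha01; rewrite k0 => kE /andP[_].
  rewrite -subr_ge0 in nlambda; rewrite add0r in kE; lra.
have omegaD V : cont_diff (fun x => omega x V).
  apply: form_cont_diff => // I.
  exact: class_C_cont_diff k0 (omegaC I).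
have cLbd : continuous (fun B => L (bd B)) by exact: (continuousT_comp _ _ _ _ _ cbd cL).
apply: (eq_on_dense R X (range iX) Ld (fun B => L (bd B)) dX cLd cLbd).
by move=> _ [S _ <-]; rewrite LdE bdE LE; exact: Stokes_fsum.
Qed.
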